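(* Let $m$, $n$ and $q$ be positive integers such that $mnq$ is even. Then \[ \sum_{k = 1}^\infty \frac{F_{2nk+mnq}}{\prod_{j=0}^{m} L_{nk+jnq}^2} = \frac{1}{5F_{mnq}}\sum_{k=1}^{q}\prod_{j=0}^{m-1}\frac{1}{L_{nk+jnq}^2}. \]
   Context: The Fibonacci numbers are defined by $F_0=0$, $F_1=1$, $F_n=F_{n-1}+F_{n-2}$, and the Lucas numbers by $L_0=2$, $L_1=1$, $L_n=L_{n-1}+L_{n-2}$. Infinite sums are limits of partial sums. *)

(* Defs.v *)
From mathcomp Require Import all_boot.

Set Implicit Arguments.
Unset Strict Implicit.
Unset Printing Implicit Defensive.

Local Open Scope nat_scope.

Fixpoint fib (n : nat) : nat :=
  match n with
  | 0 => 0
  | 1 => 1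
  | (p.+1 as n').+1 => fib n' + fib p
  end.

Fixpoint lucas (n : nat) : nat :=
  match n with
  | 0 => 2
  | 1 => 1
  | (p.+1 as n').+1 => lucas n' + lucas p
  end.

(* Main.v *)
Require Import Defs.
From mathcomp Require Import all_boot all_order all_algebra.
From mathcomp Require Import all_classical all_reals all_analysis.
From mathcomp Require Import zify ring.
Import Order.TTheory GRing.Theory Num.Theory.
Import numFieldNormedType.Exports.
Local Open Scope classical_set_scope.
Local Open Scope ring_scope.

(** For even [b], [L_(a+b)^2 - L_a^2 = 5 F_b F_(2a+b)].  With [a = nk] and
    [b = mnq] this turns the [k]-th term of the series into
    [(G k - G (k + q)) / (5 F_(mnq))], where
    [G k = \prod_(j < m) L_(nk+jnq)^(-2)]; the series then telescopes with
    step [q], and [G] tends to [0]. *)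

Lemma fibSS (n : nat) : fib n.+2 = (fib n.+1 + fib n)%N.
Proof. by []. Qed.

Lemma lucasSS (n : nat) : lucas n.+2 = (lucas n.+1 + lucas n)%N.
Proof. by []. Qed.

(** Multiplication of $\varphi^n = (L_n + F_n\sqrt5)/2$ by $\varphi$, with denominators cleared to
    stay in [nat]. *)
Lemma fib_lucas_succ (n : nat) :
  (2 * fib n.+1 = fib n + lucas n)%N /\ (2 * lucas n.+1 = 5 * fib n + lucas n)%N.
Proof.
elim: n => [//|n [IHf IHl]].
by rewrite fibSS lucasSS; lia.
Qed.

(** The two components of $\varphi^{a+b} = \varphi^a\varphi^b$. For fixed [b], both sides change by
    the same linear map when [a] grows by one. *)
Lemma fib_lucas_add (a b : nat) :
  (2 * fib (a + b) = fib a * lucas b + lucas a * fib b)%N /\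
  (2 * lucas (a + b) = lucas a * lucas b + 5 * (fib a * fib b))%N.
Proof.
elim: a => [|a [IHf IHl]]; first by rewrite add0n /=; lia.
have [Hf Hl] := fib_lucas_succ a.
have [Hfb Hlb] := fib_lucas_succ (a + b).
rewrite addSn; nia.
Qed.

(** The norm of $\varphi^n$ is $(-1)^n$; inducting in steps of two keeps the sign positive. *)
Lemma lucas_sqr_even (n : nat) : ~~ odd n ->
  (lucas n ^ 2 = 5 * fib n ^ 2 + 4)%N.
Proof.
move=> n_even; rewrite -(even_halfK n_even).
elim: n./2 => [//|k IHk].
have [Hf Hl] := fib_lucas_succ k.*2.
by rewrite doubleS fibSS lucasSS; nia.
Qed.

Lemma lucas_sqr_sub (a b : nat) : ~~ odd b ->
  (lucas (a + b) ^ 2 = lucas a ^ 2 + 5 * fib b * fib (2 * a + b))%N.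
Proof.
move=> b_even.
have Lb : (lucas b ^ 2 = 5 * fib b ^ 2 + 4)%N by exact: lucas_sqr_even.
have [Hf Hl] := fib_lucas_add a b.
have [Hg _] := fib_lucas_add a (a + b).
have -> : (2 * a + b = a + (a + b))%N by lia.
(* The factor 4 makes the doubled addition formulas applicable on both sides. *)
apply/eqP; rewrite -(eqn_pmul2l (isT : (0 < 4)%N)); apply/eqP.
transitivity ((2 * lucas (a + b)) ^ 2)%N; first by ring.
transitivity (4 * lucas a ^ 2 + 5 * fib b *
    (fib a * (2 * lucas (a + b)) + lucas a * (2 * fib (a + b))))%N; last first.
  by nia.
rewrite Hf Hl.
(* Expanding isolates [lucas b ^ 2], the one place where the parity of [b] enters. *)
transitivity (lucas a ^ 2 * lucas b ^ 2 +
  10 * lucas a * lucas b * fib a * fib b + 25 * fib a ^ 2 * fib b ^ 2)%N.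
  by ring.
by rewrite Lb; ring.
Qed.

Lemma leq_lucas (n : nat) : (n <= lucas n)%N.
Proof.
(* The recurrence looks back two terms, so the induction carries two consecutive bounds; positivity
   supplies the extra unit. *)
suff: (n <= lucas n)%N && (0 < lucas n)%N && (n < lucas n.+1)%N by lia.
by elim: n => [//|n IHn]; rewrite lucasSS; lia.
Qed.

Lemma lucas_gt0 (n : nat) : (0 < lucas n)%N.
Proof. by case: n => [//|n]; exact: leq_trans (leq_lucas n.+1). Qed.

Lemma fib_gt0 (n : nat) : (0 < n)%N -> (0 < fib n)%N.
Proof.
case: n => [//|n] _; elim: n => [//|n IHn].
by rewrite fibSS addn_gt0 IHn.
Qed.

(** By induction on [q]: raising the step by one adds an ordinary telescoping sum, equal to
    [G q.+1 - G (N + q.+1)], whose last term vanishes in the limit. *)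
Lemma cvg_telescope_step (R : realType) (G : nat -> R) (q : nat) :
  G @ \oo --> (0 : R) ->
  (fun N : nat => \sum_(1 <= k < N.+1) (G k - G (k + q)%N)) @ \oo -->
  \sum_(1 <= k < q.+1) G k.
Proof.
move=> G0; elim: q => [|q IHq].
  rewrite big_geq //; under eq_fun do
    (under eq_bigr do rewrite addn0 subrr; rewrite big1_eq).
  exact: cvg_cst.
rewrite big_nat_recr //=.
have split_sum (N : nat) : \sum_(1 <= k < N.+1) (G k - G (k + q.+1)%N) =
    \sum_(1 <= k < N.+1) (G k - G (k + q)%N) + (G q.+1 - G (N + q.+1)%N).
  rewrite -[G q.+1 - _]opprB -[in RHS]addSnnS -[q.+1 in RHS]add1n.
  rewrite -(telescope_sumr (fun k => G (k + q)%N)) // -sumrB.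
  by apply: eq_bigr => k _; rewrite addnS addSn; ring.
under eq_fun do rewrite split_sum.
apply: cvgD => //; rewrite -[X in _ --> X]subr0.
apply: cvgB; first exact: cvg_cst.
by rewrite (cvg_shiftn q.+1).
Qed.

Theorem theorem2p42 (R : realType) (m n q : nat)
  (hm : (0 < m)%N) (hn : (0 < n)%N) (hq : (0 < q)%N)
  (hmnq : ~~ odd (m * n * q)) :
  (fun N : nat =>
     \sum_(1 <= k < N.+1)
       (fib (2 * n * k + m * n * q))%:R
         / (\prod_(0 <= j < m.+1) (lucas (n * k + j * n * q))%:R ^+ 2) : R)
    @ \oo -->
  (1 / (5 * (fib (m * n * q))%:R)
    * (\sum_(1 <= k < q.+1)
         \prod_(0 <= j < m) (1 / (lucas (n * k + j * n * q))%:R ^+ 2)) : R).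
Proof.
have L0 i : (lucas i)%:R != 0 :> R by rewrite pnatr_eq0 -lt0n lucas_gt0.
have F0 : (fib (m * n * q))%:R != 0 :> R.
  by rewrite pnatr_eq0 -lt0n fib_gt0 // !muln_gt0 hm hn.
pose G k : R := \prod_(0 <= j < m) (1 / (lucas (n * k + j * n * q))%:R ^+ 2).
have termE k : (fib (2 * n * k + m * n * q))%:R
      / (\prod_(0 <= j < m.+1) (lucas (n * k + j * n * q))%:R ^+ 2) =
    1 / (5 * (fib (m * n * q))%:R) * (G k - G (k + q)%N).
  (* Replacing [k] by [k + q] shifts [j] by one, so [P] collects the factors common to [G k] and
     [G (k + q)]; only the end factors [j = 0] and [j = m] differ. *)
  pose P : R := \prod_(1 <= j < m) (lucas (n * k + j * n * q))%:R ^+ 2.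
  have P0 : P != 0.
    by rewrite prodf_seq_neq0; apply/allP => j _; rewrite expf_neq0.
  have GkE : G k = 1 / ((lucas (n * k))%:R ^+ 2 * P).
    rewrite /G; under eq_bigr do rewrite div1r.
    by rewrite prodfV big_ltn // !mul0n addn0 div1r.
  have GkqE : G (k + q)%N = 1 / (P * (lucas (n * k + m * n * q))%:R ^+ 2).
    rewrite /G; under eq_bigr do rewrite div1r.
    rewrite prodfV div1r /P; congr (_^-1).
    rewrite -big_nat_recr //= big_add1 /=; apply: eq_bigr => j _.
    by congr ((lucas _)%:R ^+ 2); lia.
  rewrite GkE GkqE big_ltn // big_nat_recr //= !mul0n addn0 -/P.
  have := congr1 (fun i => i%:R : R) (lucas_sqr_sub (n * k) _ hmnq).
  rewrite natrD 2!natrX 2!natrM mulnA => sqrE.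
  have -> : (fib (2 * n * k + m * n * q))%:R =
      ((lucas (n * k + m * n * q))%:R ^+ 2 - (lucas (n * k))%:R ^+ 2)
        / (5 * (fib (m * n * q))%:R) :> R.
    by rewrite sqrE; field.
  by field; rewrite ?P0 ?L0 ?F0.
have G_ge0 k : 0 <= G k by apply: prodr_ge0 => j _; rewrite divr_ge0 ?exprn_ge0.
(* [harmonic k] is $1/(k+1)$, hence the shifted index. The factor [j = 0] gives this bound through
   [leq_lucas]; the others are at most 1. *)
have G_le k : G k.+1 <= harmonic k.
  have inv_le1 i : 1 / (lucas i)%:R ^+ 2 <= 1 :> R.
    rewrite div1r invf_le1 ?exprn_gt0 ?ltr0n ?lucas_gt0 //.
    by rewrite exprn_ege1 // ler1n lucas_gt0.
  rewrite /G big_ltn //= -[leRHS]mulr1; apply: ler_pM => //.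
  - by apply: prodr_ge0 => j _; rewrite divr_ge0 ?exprn_ge0.
  - rewrite div1r lef_pV2 ?posrE ?exprn_gt0 ?ltr0n ?lucas_gt0 // -natrX ler_nat.
    have := leq_lucas (n * k.+1 + 0 * n * q); nia.
  - by apply: prodr_ile1 => j _; rewrite inv_le1 divr_ge0 ?exprn_ge0.
have cvgG : G @ \oo --> (0 : R).
  rewrite -cvg_shiftS.
  apply: (squeeze_cvgr _ (cvg_cst 0) cvg_harmonic).
  by apply: nearW => k; rewrite G_ge0 G_le.
under eq_fun do (under eq_bigr do rewrite termE; rewrite -big_distrr /=).
by apply: cvgMr; exact: cvg_telescope_step.
Qed.
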